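(* Let $n,r\geq 1$ and let $p$ be a prime with $p>\binom{r+1}{2}$. Let $\mathcal{U}_{L_1},\ldots,\mathcal{U}_{L_r}$ be hyperplanes over $\mathbb{Z}_p^n$ such that $\{\mathcal{U}_{L_1},\ldots,\mathcal{U}_{L_r}\}$ is admissible. Assume that the function $\Psi:\mathbb{Z}_p^n\to\mathbb{Z}_p$ has a strong Taylor expansion of order $r$ at the point $(0,\ldots,0)$, and that $$\Psi(s_1p,\ldots,s_np)\equiv 0\pmod{p^r}$$ for each $(s_1,\ldots,s_n)\in\bigcup_{i=1}^r\mathcal{U}_{L_i}$. Then $\Psi(s_1p,\ldots,s_np)\equiv 0\pmod{p^r}$ for every $(s_1,\ldots,s_n)\in\mathbb{Z}_p^n$.
   Context: $\mathbb{Z}_p$ is the ring of $p$-adic integers and $\mathbb{F}_p=\{0,1,\ldots,p-1\}$ the field with $p$ elements; $\tau_p:\mathbb{Z}_p\to\mathbb{F}_p$ is reduction mod $p$, $\tau_p(x)=\langle x\rangle_p$ (least nonnegative residue of $x$ mod $p$). A function $\Psi:\mathbb{Z}_p^n\to\mathbb{Z}_p$ has a strong Taylor expansion of order $r$ at $(\alpha_1,\ldots,\alpha_n)$ if there exist $A_{k_1,\ldots,k_n}\in\mathbb{Z}_p$ such that for all $t_1,\ldots,t_n\in\mathbb{Z}_p$, $$\Psi(\alpha_1+t_1p,\ldots,\alpha_n+t_np)\equiv \Psi(\alpha_1,\ldots,\alpha_n)+\sum_{\substack{k_1,\ldots,k_n\geq0\\ 1\leq k_1+\cdots+k_n\leq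 r}}\frac{A_{k_1,\ldots,k_n}}{k_1!\cdots k_n!}\prod_{i=1}^n(t_ip)^{k_i}\pmod{p^{r+1}}.$$ For a linear function $L(x_1,\ldots,x_n)=a_1x_1+\cdots+a_nx_n+b$ with $a_i,b\in\mathbb{Z}_p$ and $p\nmid a_j$ for some $j$, the hyperplane over $\mathbb{Z}_p^n$ is $\mathcal{U}_L=\{(x_1,\ldots,x_n)\in\mathbb{Z}_p^n: L(x_1,\ldots,x_n)=0\}$, and $\tau_p(\mathcal{U}_L)=\{(\tau_p(x_1),\ldots,\tau_p(x_n)):(x_1,\ldots,x_n)\in\mathcal{U}_L\}\subseteq\mathbb{F}_p^n$. A family $\{\mathcal{U}_{L_1},\ldots,\mathcal{U}_{L_r}\}$ is admissible if $\tau_p(\mathcal{U}_{L_i})\neq\tau_p(\mathcal{U}_{L_j})$ for all $1\leq i<j\leq r$. *)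

(* Defs.v *)
From HB Require Import structures.
From mathcomp Require Import all_boot all_order all_algebra.
From mathcomp Require Import boolp classical_sets.

Set Implicit Arguments.
Unset Strict Implicit.
Unset Printing Implicit Defensive.

Import Order.TTheory GRing.Theory Num.Theory.
Local Open Scope ring_scope.

(* Z_p as the inverse limit of the rings Z/p^k: [x k] is the least nonnegative
   residue of x modulo p^k.  The equation in [padic_resP] asserts both that
   [x k] is a reduced residue and that it is compatible with [x k.+1].  The
   proof of primality is a parameter so that Z_p carries its integral domain
   structure, and hence a field of fractions. *)
Record padic_int (p : nat) (p_pr : prime p) := PadicInt {
  padic_res :> nat -> int;
  padic_resP : forall k : nat,
    padic_res k = (padic_res k.+1 %% (p ^ k)%N%:Z)%Z
}.

Lemma modz_dvdm (m c d : int) : (c %| d)%Z -> ((m %% d)%Z = m %[mod c])%Z.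
Proof.
by case/dvdzP=> e ->; rewrite [in RHS](divz_eq m (e * c)) mulrA modzMDl.
Qed.

Section PadicRing.
Variables (p : nat) (p_pr : prime p).
Local Notation Z_p := (padic_int p_pr).
Local Notation q k := ((p ^ k)%N%:Z).

HB.instance Definition _ := gen_eqMixin Z_p.
HB.instance Definition _ := gen_choiceMixin Z_p.

Lemma padic_ext (x y : Z_p) : (forall k, x k = y k) -> x = y.
Proof.
case: x y => [x xP] [y yP] /= /funext exy; subst y.
by congr PadicInt; apply: Prop_irrelevance.
Qed.

Lemma padic_mod (x : Z_p) k : (x k %% q k)%Z = x k.
Proof. by rewrite padic_resP modz_mod. Qed.

Fact padic_make_subproof (f : nat -> int) :
  (forall k, (f k.+1 = f k %[mod q k])%Z) ->
  forall k, (f k %% q k)%Z = ((f k.+1 %% q k.+1)%Z %% q k)%Z.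
Proof.
move=> fP k; rewrite modz_dvdm ?fP //.
by rewrite expnS PoszM dvdz_mull.
Qed.

Definition padic_make f fP : Z_p := PadicInt p_pr (@padic_make_subproof f fP).

Fact padic_cst_subproof (a : int) k : (a = a %[mod q k])%Z.
Proof. by []. Qed.
Fact padic_opp_subproof (x : Z_p) k : (- x k.+1 = - x k %[mod q k])%Z.
Proof. by rewrite (padic_resP x k) modzNm. Qed.
Fact padic_add_subproof (x y : Z_p) k :
  (x k.+1 + y k.+1 = x k + y k %[mod q k])%Z.
Proof. by rewrite (padic_resP x k) (padic_resP y k) modzDm. Qed.
Fact padic_mul_subproof (x y : Z_p) k :
  (x k.+1 * y k.+1 = x k * y k %[mod q k])%Z.
Proof. by rewrite (padic_resP x k) (padic_resP y k) modzMm. Qed.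

Definition padic_cst a := padic_make (@padic_cst_subproof a).
Definition padic_opp x := padic_make (@padic_opp_subproof x).
Definition padic_add x y := padic_make (@padic_add_subproof x y).
Definition padic_mul x y := padic_make (@padic_mul_subproof x y).

Fact padic_addA : associative padic_add.
Proof. by move=> x y z; apply: padic_ext => k /=; rewrite modzDml modzDmr addrA. Qed.
Fact padic_addC : commutative padic_add.
Proof. by move=> x y; apply: padic_ext => k /=; rewrite addrC. Qed.
Fact padic_add0 : left_id (padic_cst 0) padic_add.
Proof. by move=> x; apply: padic_ext => k /=; rewrite mod0z add0r padic_mod. Qed.
Fact padic_addN : left_inverse (padic_cst 0) padic_opp padic_add.
Proof. by move=> x; apply: padic_ext => k /=; rewrite modzDml addNr. Qed.

HB.instance Definition _ := GRing.isZmodule.Build Z_p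
  padic_addA padic_addC padic_add0 padic_addN.

Fact padic_mulA : associative padic_mul.
Proof. by move=> x y z; apply: padic_ext => k /=; rewrite modzMml modzMmr mulrA. Qed.
Fact padic_mulC : commutative padic_mul.
Proof. by move=> x y; apply: padic_ext => k /=; rewrite mulrC. Qed.
Fact padic_mul1 : left_id (padic_cst 1) padic_mul.
Proof. by move=> x; apply: padic_ext => k /=; rewrite modzMml mul1r padic_mod. Qed.
Fact padic_mulD : left_distributive padic_mul padic_add.
Proof.
by move=> x y z; apply: padic_ext => k /=; rewrite modzMml modzDm mulrDl.
Qed.
Fact padic_oner_neq0 : padic_cst 1 != 0.
Proof.
apply/eqP => /(congr1 (fun x : Z_p => x 1%N)) /=.
by rewrite expn1 !modz_nat mod0n modn_small ?prime_gt1.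
Qed.

HB.instance Definition _ := GRing.Zmodule_isComNzRing.Build Z_p
  padic_mulA padic_mulC padic_mul1 padic_mulD padic_oner_neq0.

Definition padic_unit : {pred Z_p} := fun x => `[< exists y, y * x = 1 >].
Definition padic_inv (x : Z_p) : Z_p :=
  if pselect (exists y, y * x = 1) is left h then projT1 (cid h) else x.

Fact padic_mulV : {in padic_unit, left_inverse 1 padic_inv *%R}.
Proof.
move=> x /asboolP h; rewrite /padic_inv; case: pselect => // h'.
by case: (cid h').
Qed.
Fact padic_unitP (x y : Z_p) : y * x = 1 -> padic_unit x.
Proof. by move=> h; apply/asboolP; exists y. Qed.
Fact padic_inv_out : {in [predC padic_unit], padic_inv =1 id}.
Proof.
move=> x /negP h; rewrite /padic_inv; case: pselect => // h'.
by case: h; apply/asboolP.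
Qed.

HB.instance Definition _ := GRing.ComNzRing_hasMulInverse.Build Z_p
  padic_mulV padic_unitP padic_inv_out.

Lemma padic_res_mod (x : Z_p) k l : (x (k + l)%N = x k %[mod q k])%Z.
Proof.
elim: l => [|l IHl]; first by rewrite addn0.
rewrite addnS -IHl (padic_resP x (k + l)) modz_dvdm //.
by rewrite expnD PoszM dvdz_mulr.
Qed.

Lemma padic_neq0 (x : Z_p) : x != 0 -> exists k, ~~ (q k %| x k)%Z.
Proof.
move=> x0; apply: contrapT => h; case/eqP: x0; apply: padic_ext => k /=.
rewrite mod0z -padic_mod; apply/dvdz_mod0P.
by case: (boolP (q k %| x k)%Z) => // xk; case: h; exists k.
Qed.

Fact padic_mulf_eq0 (x y : Z_p) : x * y = 0 -> (x == 0) || (y == 0).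
Proof.
move=> xy0; case: (boolP ((x == 0) || _)) => //; rewrite negb_or => /andP[].
move=> /padic_neq0[k xk] /padic_neq0[l yl].
have xkl : ~~ (q k %| x (k + l)%N)%Z.
  by apply: contra xk => /dvdz_mod0P; rewrite padic_res_mod => /dvdz_mod0P.
have ykl : ~~ (q l %| y (k + l)%N)%Z.
  by apply: contra yl => /dvdz_mod0P; rewrite addnC padic_res_mod => /dvdz_mod0P.
have : (q (k + l)%N %| x (k + l)%N * y (k + l)%N)%Z.
  apply/dvdz_mod0P.
  by have := congr1 (fun z : Z_p => z (k + l)%N) xy0; rewrite /= mod0z.
move: xkl ykl; rewrite !dvdzE !abszM /=; move: `|x _|%N `|y _|%N => a b.
have [-> |a0] := posnP a; first by rewrite dvdn0.
have [-> |b0] := posnP b; first by rewrite dvdn0.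
rewrite !pfactor_dvdn ?muln_gt0 ?a0 // lognM // -!ltnNge => ak bl.
by rewrite leqNgt -addSn leq_add // ltnW.
Qed.

HB.instance Definition _ :=
  GRing.ComUnitRing_isIntegral.Build Z_p padic_mulf_eq0.

End PadicRing.

Section StrongTaylor.
Variables (p : nat) (p_pr : prime p).
Local Notation Z_p := (padic_int p_pr).
Local Notation Q_p := {fraction Z_p}.
Local Notation "x %:F" := (tofrac x).
Local Open Scope classical_set_scope.

Definition padic_tau (x : Z_p) : 'F_p := (x 1%N)%:~R.

Definition padic_eqmod (m : nat) (x y : Z_p) : Prop :=
  exists z : Z_p, x - y = z * p%:R ^+ m.

(* x = y mod p^m Z_p for x, y in Q_p; the terms of a Taylor expansion have the
   denominators k_1! ... k_n!, which need not be units of Z_p in general *)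
Definition padic_frac_eqmod (m : nat) (x y : Q_p) : Prop :=
  exists z : Z_p, x - y = (z * p%:R ^+ m)%:F.

(* Exponents run over {0, ..., r}, as k_1 + ... + k_n <= r forces k_i <= r. *)
Definition strong_taylor (n r : nat) (Psi : 'rV[Z_p]_n -> Z_p)
    (alpha : 'rV[Z_p]_n) : Prop :=
  exists A : {ffun 'I_n -> 'I_r.+1} -> Z_p, forall t : 'rV[Z_p]_n,
    padic_frac_eqmod r.+1
      (Psi (alpha + p%:R *: t))%:F
      ((Psi alpha)%:F +
       \sum_(k : {ffun 'I_n -> 'I_r.+1} | (1 <= \sum_i k i <= r)%N)
          (A k)%:F / (\prod_i (k i)`!)%N%:R *
          \prod_i (t 0 i * p%:R)%:F ^+ k i).

Definition padic_linear (n : nat) (a : 'rV[Z_p]_n) (b : Z_p)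
    (x : 'rV[Z_p]_n) : Z_p :=
  \sum_i a 0 i * x 0 i + b.

Definition is_hyperplane (n : nat) (U : set 'rV[Z_p]_n) : Prop :=
  exists (a : 'rV[Z_p]_n) (b : Z_p),
    (exists j, ~ padic_eqmod 1 (a 0 j) 0) /\
    U = [set x | padic_linear a b x = 0].

Definition tau_set (n : nat) (U : set 'rV[Z_p]_n) : set 'rV['F_p]_n :=
  map_mx padic_tau @` U.

Definition admissible (n r : nat) (U : 'I_r -> set 'rV[Z_p]_n) : Prop :=
  forall i j : 'I_r, (i < j)%N -> tau_set (U i) <> tau_set (U j).

End StrongTaylor.

(* Main.v *)
From HB Require Import structures.
Require Import Defs.
From mathcomp Require Import all_boot all_order all_algebra zify.
From mathcomp Require Import boolp classical_sets.

(* Modulo p^r, t |-> Psi (p (s + t v)) is a polynomial of degree < r over Z_p,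
   so it vanishes identically as soon as it does at r points that are distinct
   mod p.  If s lies off all the hyperplanes mod p, a line through s meets them
   at r such points provided its direction avoids 'C(r + 1, 2) < p linear
   forms: the r forms a_i and, for i < j, the form L_j(s) a_i - L_i(s) a_j,
   which is nonzero mod p by admissibility.  An arbitrary s lies on a line not
   parallel to any hyperplane, with at least p - r >= r points off all of them
   mod p, where the first case applies. *)

Set Implicit Arguments.
Unset Strict Implicit.
Unset Printing Implicit Defensive.

Import Order.TTheory GRing.Theory Num.Theory.
Local Open Scope ring_scope.

(** * Interpolation, avoidance of linear forms, and a count of pairs *)

Lemma interpolation_dvd (R : comUnitRingType) (m : R) (ts : seq R)
    (g : {poly R}) :
  pairwise [rel x y | x - y \is a GRing.unit] ts -> (size g <= size ts)%N ->
  (forall t, t \in ts -> exists z, g.[t] = z * m) ->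
  forall x, exists z, g.[x] = z * m.
Proof.
move=> + + + x; elim: ts g => [|t ts IH] g /=.
  rewrite leqn0 size_poly_eq0 => _ /eqP-> _.
  by exists 0; rewrite horner0 mul0r.
case/andP=> /allP tU tsU szg g_ts.
(* Newton's divided difference [h = (g - g.[t]) / ('X - t)] has smaller size, and its values at the
   remaining points are multiples of [m] because each [y - t] is invertible. *)
have [z0 gt] := g_ts t (mem_head _ _).
have [h gE] : exists h, g - g.[t]%:P = h * ('X - t%:P).
  by apply/factor_theorem; rewrite /root !hornerE subrr.
have hE y : g.[y] - g.[t] = h.[y] * (y - t).
  by have := congr1 (horner^~ y) gE; rewrite !hornerE.
have szh : (size h <= size ts)%N.
  have [->|h0] := eqVneq h 0; first by rewrite size_poly0.
  have := size_polyD g (- g.[t]%:P).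
  rewrite gE size_Mmonic ?monicXsubC // size_XsubC addn2 /= => /leq_trans.
  rewrite -(ltnS (size h)); apply.
  by rewrite geq_max szg size_polyN size_polyC (leq_trans (leq_b1 _)).
have [y yts|z hx] := IH h tsU szh.
  have [zy gy] := g_ts y (mem_behead (s := t :: ts) yts).
  have U : y - t \is a GRing.unit by rewrite -opprB unitrN; apply: tU.
  exists ((zy - z0) / (y - t)).
  by rewrite mulrAC mulrBl -gy -gt hE mulrK.
exists (z * (x - t) + z0).
by rewrite -(subrK g.[t] g.[x]) hE hx gt mulrDl mulrAC.
Qed.

(* Induction on ws: if v avoids ws but w.v = 0, take u with w.u <> 0; then
   w.(u + c v) = w.u for every c, and each form of ws excludes one value of c. *)
Lemma exists_avoiding (F : finFieldType) n (ws : seq 'rV[F]_n) :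
  (size ws <= #|F|)%N -> all (predC1 0) ws ->
  exists v : 'rV[F]_n, forall w, w \in ws -> \sum_i w 0 i * v 0 i != 0.
Proof.
elim: ws => [|w ws IH] /=; first by exists 0.
move=> szw /andP[w0 /(IH (ltnW szw))[v vP]].
pose dot (a b : 'rV[F]_n) := \sum_i a 0 i * b 0 i.
have [wv|wv] := eqVneq (dot w v) 0; last first.
  by exists v => x; rewrite inE => /predU1P[->//|/vP].
have [j wj] : exists j, w 0 j != 0.
  by have /rV0Pn[j] := w0; exists j.
pose u : 'rV[F]_n := delta_mx 0 j.
have wu : dot w u = w 0 j.
  rewrite /dot (bigD1 j) //= mxE !eqxx mulr1 big1 ?addr0 // => i ij.
  by rewrite mxE (negPf ij) andbF mulr0.
pose bad := [seq - dot x u / dot x v | x <- ws].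
have [c cP] : exists c, c \notin bad.
  apply/existsP; rewrite -negb_forall; apply/negP => /forallP badT.
  have : (#|F| <= size bad)%N.
    by apply: leq_trans (card_size bad); apply: subset_leq_card; apply/fintype.subsetP => c _.
  by rewrite size_map leqNgt szw.
have dotE x : dot x (u + c *: v) = dot x u + c * dot x v.
  rewrite /dot mulr_sumr -big_split /=; apply: eq_bigr => i _.
  by rewrite !mxE mulrDr mulrCA.
exists (u + c *: v) => x; rewrite inE => /predU1P[->|xws].
  by rewrite -/(dot _ _) dotE wv mulr0 addr0 wu.
rewrite -/(dot _ _) dotE addrC addr_eq0; apply: contra cP => /eqP cE.
by apply/mapP; exists x => //; rewrite -cE mulfK // vP.
Qed.

(** This is the number of linear forms that a transversal direction must avoid: one for each [i] and
    one for each pair [i < j]. Row [j] contributes [j + 1] pairs. *)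
Lemma card_ord_le2 r : #|[pred x : 'I_r * 'I_r | (x.1 <= x.2)%N]| = 'C(r.+1, 2).
Proof.
rewrite -sum1_card (eq_bigl (fun x : 'I_r * 'I_r => (x.1 <= x.2)%N)) //.
rewrite -(pair_big_dep xpredT (fun i j : 'I_r => (i <= j)%N) (fun _ _ => 1%N)) /=.
rewrite (exchange_big_dep xpredT) //= -bin2_sum big_nat_recl // add0n big_mkord.
apply: eq_bigr => j _.
rewrite (eq_bigl (fun i : 'I_r => (i < j.+1)%N)) //.
by rewrite (big_ord_narrow (ltn_ord j)) sum1_card card_ord.
Qed.

(** * Reduction mod p: divisibility by p and units in Z_p *)

Section Padic.
Variables (p : nat) (p_pr : prime p).
Local Notation Z_p := (padic_int p_pr).
Local Notation tau := (@padic_tau p p_pr).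
Local Notation q k := ((p ^ k)%N%:Z).

Lemma intr_Fp_mod (m : int) : (m %% p%:Z)%Z%:~R = m%:~R :> 'F_p.
Proof.
rewrite [in RHS](divz_eq m p) [RHS]intrD intrM -[p%:~R]/(p%:R).
by rewrite pchar_Fp_0 // mulr0 add0r.
Qed.

Lemma padic_tauB : {morph tau : x y / x - y}.
Proof.
move=> x y; rewrite /padic_tau /= expn1 modzDmr !intr_Fp_mod.
by rewrite intrB.
Qed.

Lemma padic_tauM : monoid_morphism tau.
Proof.
split; rewrite /padic_tau /= ?expn1 ?intr_Fp_mod // => x y /=.
by rewrite expn1 intr_Fp_mod intrM.
Qed.

HB.instance Definition _ :=
  GRing.isZmodMorphism.Build Z_p 'F_p tau padic_tauB.
HB.instance Definition _ :=
  GRing.isMonoidMorphism.Build Z_p 'F_p tau padic_tauM.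

Lemma padic_tau_eq0 (x : Z_p) : (tau x == 0) = (p%:Z %| x 1%N)%Z.
Proof.
rewrite /padic_tau; have -> : x 1%N = (absz (x 1%N))%:Z.
  by rewrite gez0_abs // -padic_mod modz_ge0 // expn1 eqz_nat -lt0n prime_gt0.
rewrite dvdzE /=; set m := absz _.
by rewrite -[X in X == 0]/(m%:R) -(dvdn_pcharf (pchar_Fp p_pr)).
Qed.

Lemma padic_res_tau_eq0 (x : Z_p) k : (tau x == 0) = (p%:Z %| x k.+1)%Z.
Proof.
rewrite padic_tau_eq0; have := padic_res_mod x 1 k; rewrite expn1 add1n => xk.
by apply/dvdz_mod0P/dvdz_mod0P; rewrite xk.
Qed.

Lemma padic_natr (m : nat) : m%:R = padic_cst p_pr m :> Z_p.
Proof.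
elim: m => [//|m IH]; rewrite mulrS IH; apply: padic_ext => k /=.
by rewrite modzDm -PoszD.
Qed.

(** Division by p costs one digit: the residue of x/p modulo p^k is read off from [x k.+1], hence
    the index shift in the witness. *)
Lemma padic_tau_eqmod (x : Z_p) : tau x = 0 -> padic_eqmod 1 x 0.
Proof.
move/eqP=> x0.
have dv k : (p%:Z %| x k.+1)%Z by rewrite -padic_res_tau_eq0.
have p0 : p%:Z != 0 by rewrite eqz_nat -lt0n prime_gt0.
have zP k : ((x k.+2 %/ p)%Z = (x k.+1 %/ p)%Z %[mod q k])%Z.
  apply/eqP; rewrite eqz_mod_dvd -(dvdz_mul2r p0) mulrBl !divzK //.
  by rewrite -PoszM mulnC -expnS -eqz_mod_dvd -(addn1 k.+1) padic_res_mod.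
exists (padic_make p_pr zP); apply: padic_ext => k.
rewrite subr0 expr1 padic_natr /=.
by rewrite modzMml modzMmr divzK // -padic_resP.
Qed.

(** Bezout inverts every residue [x k] modulo p^k. The chosen inverses form a p-adic integer because
    inverses modulo p^k are unique. *)
Lemma padic_tau_unit (x : Z_p) : tau x != 0 -> x \is a GRing.unit.
Proof.
move=> x0.
have cop k : coprimez (x k) (q k).
  case: k => [|k]; first by rewrite expn0 coprimezE /= coprimen1.
  rewrite coprimezE /= coprimeXr // coprime_sym prime_coprime //.
  by move: x0; rewrite (padic_res_tau_eq0 x k) dvdzE.
have /choice[y yP] k : exists y, (y * x k = 1 %[mod q k])%Z.
  have [u [v uv]] := Bezoutz (x k) (q k); exists u.
  by rewrite -(eqP (cop k)) -uv [in RHS]addrC modzMDl.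
have yc k : (y k.+1 = y k %[mod q k])%Z.
  have yx : (y k.+1 * x k = 1 %[mod q k])%Z.
    rewrite (padic_resP x k) modzMmr.
    have qq : (q k %| q k.+1)%Z by rewrite dvdzE /= dvdn_exp2l.
    by rewrite -(modz_dvdm _ qq) yP modz_dvdm.
  by rewrite -[in LHS](mulr1 (y k.+1)) -modzMmr -(yP k) modzMmr mulrCA
     -modzMmr yx modzMmr mulr1.
apply/unitrPr; exists (padic_make p_pr yc); rewrite mulrC.
by apply: padic_ext => k /=; rewrite modzMml yP.
Qed.

Lemma padic_tau_surj (c : 'F_p) : tau (val c)%:R = c.
Proof. by rewrite rmorph_nat natr_Zp. Qed.

End Padic.

(** * Hyperplanes mod p, and the restriction of Psi to lines *)

Section Hyperplane.
Variables (p : nat) (p_pr : prime p).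
Local Notation Z_p := (padic_int p_pr).
Local Notation tau := (@padic_tau p p_pr).

Definition padic_lift_row n (y : 'rV['F_p]_n) : 'rV[Z_p]_n :=
  \row_i (val (y 0 i))%:R.

Lemma padic_lift_rowK n (y : 'rV['F_p]_n) i : tau (padic_lift_row y 0 i) = y 0 i.
Proof. by rewrite mxE padic_tau_surj. Qed.

Lemma tau_padic_linear n (a : 'rV[Z_p]_n) b x :
  tau (padic_linear a b x) = \sum_i tau (a 0 i) * tau (x 0 i) + tau b.
Proof.
rewrite rmorphD rmorph_sum /=; congr (_ + _).
by apply: eq_bigr => i _; rewrite rmorphM.
Qed.

Lemma padic_linearD n (a : 'rV[Z_p]_n) b s v t :
  padic_linear a b (s + t *: v) = padic_linear a b s + t * padic_linear a 0 v.
Proof.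
rewrite /padic_linear addr0 addrAC mulr_sumr -big_split /=; congr (_ + _).
by apply: eq_bigr => i _; rewrite !mxE mulrDr mulrCA.
Qed.

Lemma tau_hyperplane n (a : 'rV[Z_p]_n) b j : tau (a 0 j) != 0 ->
  tau_set [set x | padic_linear a b x = 0]%classic =
  [set y | \sum_i tau (a 0 i) * y 0 i + tau b = 0]%classic.
Proof.
move=> aj; apply/seteqP; split=> y /=.
  case=> x /= Lx <-; have := congr1 tau Lx; rewrite tau_padic_linear rmorph0 => {2}<-.
  by congr (_ + _); apply: eq_bigr => i _; rewrite mxE.
move=> Ly; pose x := padic_lift_row y.
have Lx : tau (padic_linear a b x) = 0.
  rewrite tau_padic_linear -[RHS]Ly; congr (_ + _).
  by apply: eq_bigr => i _; rewrite padic_lift_rowK.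
have e : padic_linear a 0 (delta_mx 0 j) = a 0 j.
  rewrite /padic_linear addr0 (bigD1 j) //= mxE !eqxx mulr1 big1 ?addr0 // => i ij.
  by rewrite mxE (negPf ij) andbF mulr0.
(* Moving the lift [x] along coordinate [j], whose coefficient is a unit, makes the equation exact.
   The correction vanishes mod p since [padic_linear a b x] does, so the point still reduces to
   [y]. *)
exists (x + (- (padic_linear a b x / a 0 j)) *: delta_mx 0 j).
  by rewrite /= padic_linearD e mulNr divrK ?subrr // padic_tau_unit.
apply/rowP => i; rewrite !mxE rmorphD rmorphM rmorphN rmorphM /= Lx.
by rewrite !mul0r oppr0 mul0r addr0 padic_tau_surj.
Qed.

Lemma padic_fact_unit m : (m < p)%N -> m`!%:R \is a @GRing.unit Z_p.
Proof.
move=> mp; apply: padic_tau_unit; rewrite rmorph_nat.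
rewrite -(dvdn_pcharf (pchar_Fp p_pr)).
elim: m mp => [|m IH] mp; first by rewrite fact0 dvdn1 neq_ltn prime_gt1 ?orbT.
by rewrite factS Euclid_dvdM // negb_or IH ?(ltnW mp) // gtnNdvd.
Qed.

(** Substituting the line turns the Taylor term of index [k] into a polynomial in [t] of degree at
    most [deg k]. Terms of total degree exactly [r] carry the factor p^r and go into the error, so
    degree less than [r] remains. *)
Lemma strong_taylor_line n r (Psi : 'rV[Z_p]_n -> Z_p) s v :
  (0 < r < p)%N -> strong_taylor r Psi 0 ->
  exists2 g : {poly Z_p}, (size g <= r)%N &
    forall t, exists z, Psi (p%:R *: (s + t *: v)) = g.[t] + z * p%:R ^+ r.
Proof.
move=> /andP[r0 rp] [A AP].
(* The factorials are units because every [k i] is at most [r < p], so this is a true quotient in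
   Z_p. *)
pose c k : Z_p := A k / (\prod_i (k i)`!)%N%:R.
pose l i : {poly Z_p} := ((s 0 i)%:P + (v 0 i)%:P * 'X) * p%:R%:P.
pose deg (k : {ffun 'I_n -> 'I_r.+1}) := (\sum_i k i)%N.
pose T k := (c k)%:P * \prod_i l i ^+ k i.
have lE t i : (l i).[t] = (s + t *: v) 0 i * p%:R.
  by rewrite /l !hornerE !mxE [v 0 i * t]mulrC.
have TE t k : (T k).[t] = c k * \prod_i ((s + t *: v) 0 i * p%:R) ^+ k i.
  rewrite /T hornerM hornerC horner_prod; congr (_ * _).
  by apply: eq_bigr => i _; rewrite horner_exp lE.
have szT k : (size (T k) <= (deg k).+1)%N.
  rewrite /T mul_polyC; apply: leq_trans (size_scale_leq _ _) _.
  apply: leq_trans (size_poly_prod_leq _ _) _.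
  rewrite leq_subLR cardT size_enum_ord addnS ltnS.
  rewrite -[X in (_ <= X + _)%N](card_ord n) -sum1_card -big_split /=.
  apply: leq_sum => i _; apply: leq_trans (size_poly_exp_leq _ _) _.
  rewrite add1n ltnS.
  have szl : (size (l i) <= 2)%N.
    rewrite /l mulrC !mul_polyC; apply: leq_trans (size_scale_leq _ _) _.
    apply: leq_trans (size_polyD _ _) _; rewrite geq_max.
    rewrite (leq_trans (size_polyC_leq1 _)) //=.
    by apply: leq_trans (size_scale_leq _ _) _; rewrite size_polyX.
  by rewrite -[X in (_ <= X)%N]mul1n leq_mul2r -subn1 leq_subLR szl orbT.
(* The condition has the shape that [bigID] produces when it splits the Taylor sum at degree [r]. *)
exists ((Psi 0)%:P + \sum_(k | (1 <= deg k <= r)%N && (deg k < r)%N) T k).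
  apply: leq_trans (size_polyD _ _) _; rewrite geq_max.
  rewrite (leq_trans (size_polyC_leq1 _)) //=.
  apply: leq_trans (size_sum _ _ _) _; apply/bigmax_leqP => k /andP[_ kr].
  exact: leq_trans (szT k) kr.
move=> t; have [z] := AP (s + t *: v); rewrite add0r.
set y := s + t *: v => /eqP.
have -> : \sum_(k : {ffun 'I_n -> 'I_r.+1} | (1 <= \sum_i k i <= r)%N)
    tofrac (A k) / (\prod_i (k i)`!)%N%:R *
      \prod_i tofrac (y 0 i * p%:R) ^+ k i =
    tofrac (\sum_(k | (1 <= deg k <= r)%N) (T k).[t]).
  rewrite rmorph_sum; apply: eq_bigr => k _.
  rewrite TE rmorphM rmorph_div /=; last first.
    rewrite natr_prod rpred_prod // => i _.
    by rewrite padic_fact_unit // (leq_ltn_trans _ rp) // -ltnS.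
  rewrite rmorph_nat -/y; congr (_ * _); rewrite rmorph_prod.
  by apply: eq_bigr => i _; rewrite rmorphXn.
rewrite -tofracD -tofracB tofrac_eq subr_eq => /eqP ->.
rewrite (bigID (fun k => deg k < r)%N) /= hornerD hornerC horner_sum.
(* The degree [r] terms with p^r taken out, plus the remainder modulo p^(r+1), of which one factor p
   is left. *)
exists (\sum_(k | (1 <= deg k <= r)%N && ~~ (deg k < r)%N)
  c k * \prod_i y 0 i ^+ k i + z * p%:R).
rewrite mulrDl -mulrA -exprS [LHS]addrC !addrA; congr (_ + _ + _ + _).
rewrite mulr_suml; apply: eq_bigr => k /andP[/andP[_ kr]]; rewrite -leqNgt => rk.
have <- : p%:R ^+ deg k = p%:R ^+ r :> Z_p.
  by congr (_ ^+ _); apply/eqP; rewrite eqn_leq rk kr.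
rewrite TE -[RHS]mulrA; congr (_ * _).
by rewrite /deg expr_sum -big_split /=; apply: eq_bigr => i _; rewrite exprMn.
Qed.

Lemma strong_taylor_vanish_line n r (Psi : 'rV[Z_p]_n -> Z_p) s v (ts : seq Z_p) :
  (0 < r < p)%N -> strong_taylor r Psi 0 ->
  uniq (map tau ts) -> (r <= size ts)%N ->
  (forall t, t \in ts -> padic_eqmod r (Psi (p%:R *: (s + t *: v))) 0) ->
  padic_eqmod r (Psi (p%:R *: s)) 0.
Proof.
move=> rp Psi_taylor ts_uniq szts Psi_ts.
have [g szg gP] := strong_taylor_line s v rp Psi_taylor.
have [z0] := gP 0; rewrite scale0r addr0 => Ps.
(* Interpolation is evaluated at [t = 0], the parameter of [s]. Nodes distinct mod p have unit
   differences. *)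
have [|t /Psi_ts[z]|z gz] :=
  @interpolation_dvd _ (p%:R ^+ r) ts g _ (leq_trans szg szts) _ 0.
- move: ts_uniq; rewrite uniq_pairwise pairwise_map.
  apply: sub_pairwise => x y /= xy; apply: padic_tau_unit.
  by rewrite rmorphB subr_eq0.
- rewrite subr0 => Pz; have [z1 Pt] := gP t.
  exists (z - z1).
  by rewrite mulrBl -Pz Pt addrK.
by exists (z + z0); rewrite subr0 Ps gz mulrDl.
Qed.

End Hyperplane.

(** Turns the hypothesis on p into 2r <= p; equality holds for [r] equal to 1 and 2. *)
Lemma double_leq_bin2 r : (0 < r)%N -> (r + r <= 'C(r.+1, 2).+1)%N.
Proof.
case: r => // r _; elim: r => [//|r IH].
by rewrite binS bin1 addnS addSn; lia.
Qed.

(** * Choice of lines and of parameters on them *)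

Section Transversal.
Variables (p : nat) (p_pr : prime p) (n r : nat).
Local Notation Z_p := (padic_int p_pr).
Local Notation tau := (@padic_tau p p_pr).
Variables (a : 'I_r -> 'rV[Z_p]_n) (b : 'I_r -> Z_p).
Hypothesis aP : forall i, exists j, tau (a i 0 j) != 0.

(** Up to sign, the quotients in the conclusion are the parameters mod p at which the line through
    [s] meets the hyperplanes. Cross-multiplying, two of them agree exactly when the direction kills
    the form [w (i, j)]. *)
Lemma exists_transversal_direction (s : 'rV[Z_p]_n) :
  ('C(r.+1, 2) <= p)%N ->
  admissible (fun i => [set x | padic_linear (a i) (b i) x = 0]%classic) ->
  (forall i, tau (padic_linear (a i) (b i) s) != 0) ->
  exists v : 'rV[Z_p]_n,
    (forall i, tau (padic_linear (a i) 0 v) != 0) /\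
    injective (fun i =>
      tau (padic_linear (a i) (b i) s) / tau (padic_linear (a i) 0 v)).
Proof.
move=> r_le adm Ls; pose L i := tau (padic_linear (a i) (b i) s).
pose abar i := map_mx tau (a i).
pose w (x : 'I_r * 'I_r) :=
  if x.1 == x.2 then abar x.1 else L x.2 *: abar x.1 - L x.1 *: abar x.2.
pose ws := [seq w x | x <- enum [pred x : 'I_r * 'I_r | (x.1 <= x.2)%N]].
have abar0 i : abar i != 0.
  by have [j aj] := aP i; apply/rV0Pn; exists j; rewrite mxE.
have [||v vP] := @exists_avoiding 'F_p n ws.
- by rewrite size_map -cardE card_ord_le2 card_Fp.
- apply/allP => x /mapP[[i j]]; rewrite mem_enum inE /= => ij ->.
  rewrite /= /w /=; case: (eqVneq i j) => [_|ij']; first exact: abar0.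
  rewrite subr_eq0; apply/eqP => wE.
  have lt_ij : (i < j)%N by rewrite ltn_neqAle ij andbT.
  apply: (adm i j lt_ij).
  have [[ji aji] [jj ajj]] := (aP i, aP j).
  rewrite (tau_hyperplane _ aji) (tau_hyperplane _ ajj).
  have LyE k (y : 'rV['F_p]_n) : \sum_l tau (a k 0 l) * y 0 l + tau (b k) =
      L k + \sum_l tau (a k 0 l) * (y 0 l - tau (s 0 l)).
    rewrite /L tau_padic_linear addrAC -big_split /=; congr (_ + _).
    by apply: eq_bigr => l _; rewrite mulrBr addrC subrK.
  (* Expanded around [s], the two affine forms have constant terms [L i] and [L j], so
     proportionality of their linear parts extends to the whole forms. Both factors are nonzero, so
     the zero sets coincide, against admissibility. *)
  have key (y : 'rV['F_p]_n) : L j * (\sum_l tau (a i 0 l) * y 0 l + tau (b i)) =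
      L i * (\sum_l tau (a j 0 l) * y 0 l + tau (b j)).
    rewrite !LyE !mulrDr mulrC; congr (_ + _).
    rewrite !mulr_sumr; apply: eq_bigr => l _; rewrite !mulrA; congr (_ * _).
    by have /rowP/(_ l) := wE; rewrite !mxE.
  apply/seteqP; split=> y /= yE.
  - have /esym/eqP := key y; rewrite yE mulr0.
    by rewrite mulf_eq0 (negPf (Ls i)) => /eqP.
  - have /eqP := key y; rewrite yE mulr0.
    by rewrite mulf_eq0 (negPf (Ls j)) => /eqP.
pose v' := padic_lift_row p_pr v.
have dotE i : tau (padic_linear (a i) 0 v') = \sum_l abar i 0 l * v 0 l.
  rewrite tau_padic_linear rmorph0 addr0; apply: eq_bigr => l _.
  by rewrite padic_lift_rowK mxE.
have wP (i j : 'I_r) : (i <= j)%N -> \sum_l w (i, j) 0 l * v 0 l != 0.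
  by move=> ij; apply: vP; apply/mapP; exists (i, j); rewrite // mem_enum.
have v0 i : tau (padic_linear (a i) 0 v') != 0.
  by have := wP i i (leqnn i); rewrite /w eqxx dotE.
exists v'; split=> // i j; rewrite -/(L i) -/(L j).
wlog ij : i j / (i <= j)%N.
  by move=> H e; case: (leqP i j) => [|/ltnW] /H; [exact|move=> ->].
move/eqP; rewrite eqr_div // => /eqP e; apply/eqP; apply: contraT => nij.
have := wP i j ij; rewrite /w /= (negPf nij).
suff -> : \sum_l (L j *: abar i - L i *: abar j) 0 l * v 0 l =
    L j * tau (padic_linear (a i) 0 v') - L i * tau (padic_linear (a j) 0 v').
  by rewrite e subrr eqxx.
rewrite !dotE !mulr_sumr -sumrB; apply: eq_bigr => l _.
by rewrite !mxE mulrBl !mulrA.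
Qed.

Lemma exists_off_hyperplanes (s v : 'rV[Z_p]_n) :
  (r + r <= p)%N -> (forall i, tau (padic_linear (a i) 0 v) != 0) ->
  exists ts : seq Z_p, [/\ uniq (map tau ts), (r <= size ts)%N &
    forall t i, t \in ts -> tau (padic_linear (a i) (b i) (s + t *: v)) != 0].
Proof.
move=> rp v0.
(* The only residue of the parameter at which the line meets hyperplane [i] mod p. At most [r]
   residues are thus excluded, and at least p - r >= r are left. *)
pose root i := - tau (padic_linear (a i) (b i) s) / tau (padic_linear (a i) 0 v).
pose good := [seq c <- enum 'F_p | c \notin codom root].
exists [seq (val c)%:R | c <- good].
have goodE : [seq tau x | x <- [seq (val c)%:R | c <- good]] = good.
  by rewrite -map_comp -[RHS]map_id; apply: eq_map => c /=; rewrite padic_tau_surj.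
split.
- by rewrite goodE filter_uniq ?enum_uniq.
- rewrite size_map size_filter.
  have := count_predC (mem (codom root)) (enum 'F_p).
  rewrite -cardE card_Fp // -size_filter.
  rewrite -(card_uniqP (filter_uniq _ (enum_uniq _))).
  have : (#|[seq x <- enum 'F_p | mem (codom root) x]| <= r)%N.
    have := card_size (codom root); rewrite size_codom card_ord; apply: leq_trans.
    apply/subset_leq_card/fintype.subsetP => c.
    by rewrite mem_filter => /andP[].
  move=> h /=; set m := count _ _ => e; have : (r + r <= r + m)%N.
    by apply: leq_trans rp _; rewrite -e leq_add2r.
  by rewrite leq_add2l.
- move=> t i /mapP[c]; rewrite mem_filter => /andP[cr _] ->.
  rewrite padic_linearD rmorphD rmorphM /= padic_tau_surj.
  apply: contra cr; rewrite addrC addr_eq0 => /eqP e.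
  by apply/codomP; exists i; rewrite /root -e mulfK.
Qed.

End Transversal.

(** * Vanishing off the hyperplanes, then everywhere *)

Theorem theorem1p1 (n r p : nat) (p_pr : prime p)
    (n_gt0 : (1 <= n)%N) (r_gt0 : (1 <= r)%N) (p_gt : ('C(r.+1, 2) < p)%N)
    (U : 'I_r -> set 'rV[padic_int p_pr]_n)
    (U_hyp : forall i, is_hyperplane (U i))
    (U_adm : admissible U)
    (Psi : 'rV[padic_int p_pr]_n -> padic_int p_pr)
    (Psi_taylor : strong_taylor r Psi 0)
    (Psi_U : forall s : 'rV[padic_int p_pr]_n,
       (\bigcup_i U i)%classic s -> padic_eqmod r (Psi (p%:R *: s)) 0) :
  forall s : 'rV[padic_int p_pr]_n, padic_eqmod r (Psi (p%:R *: s)) 0.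
Proof.
have r2p : (r + r <= p)%N := leq_trans (double_leq_bin2 r_gt0) p_gt.
have rp : (0 < r < p)%N by rewrite r_gt0 (leq_trans _ r2p) // -addn1 leq_add2l.
have /choice[ab abP] i : exists ab : 'rV[padic_int p_pr]_n * padic_int p_pr,
    (exists j, padic_tau (ab.1 0 j) != 0) /\
    U i = [set x | padic_linear ab.1 ab.2 x = 0]%classic.
  have [a [b [[j aj] ->]]] := U_hyp i; exists (a, b); split=> //; exists j.
  by apply/eqP => /padic_tau_eqmod.
pose a i := (ab i).1; pose b i := (ab i).2.
have aP i : exists j, padic_tau (a i 0 j) != 0 by have [] := abP i.
have UE : U = fun i => [set x | padic_linear (a i) (b i) x = 0]%classic.
  by apply/funext => i; have [] := abP i.
have off_vanish s :
    (forall i, padic_tau (padic_linear (a i) (b i) s) != 0) ->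
    padic_eqmod r (Psi (p%:R *: s)) 0.
  move=> Ls; rewrite UE in U_adm.
  have [v [v0 vI]] := exists_transversal_direction aP (ltnW p_gt) U_adm Ls.
  (* The denominator is a unit, so this parameter is p-adic and its point lies on [U i] exactly, not
     only mod p, as [Psi_U] requires. *)
  pose t i := - padic_linear (a i) (b i) s / padic_linear (a i) 0 v.
  apply: (@strong_taylor_vanish_line _ _ _ _ _ s v (codom t) rp Psi_taylor).
  - rewrite /codom /image_mem -map_comp map_inj_uniq ?enum_uniq // => i j /=.
    rewrite /t !mulNr !rmorphN !rmorph_div ?padic_tau_unit //=.
    by move/oppr_inj/vI.
  - by rewrite size_codom card_ord.
  move=> _ /codomP[i ->]; apply: Psi_U; exists i => //.
  by rewrite UE /= padic_linearD /t divrK ?padic_tau_unit // subrr.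
move=> s.
(* For arbitrary [s], only the [r] linear parts have to be avoided. The points of this line to which
   [off_vanish] applies then serve as interpolation nodes. *)
have [||v vP] :=
  @exists_avoiding 'F_p n [seq map_mx (@padic_tau p p_pr) (a i) | i <- enum 'I_r].
- rewrite size_map size_enum_ord card_Fp //.
  by case/andP: rp => _ /ltnW.
- apply/allP => _ /mapP[i _ ->]; apply/rV0Pn.
  by have [j aj] := aP i; exists j; rewrite mxE.
have v0 i : padic_tau (padic_linear (a i) 0 (padic_lift_row p_pr v)) != 0.
  rewrite tau_padic_linear rmorph0 addr0.
  have := vP _ (map_f _ (mem_enum 'I_r i)); congr (_ != 0).
  by apply: eq_bigr => l _; rewrite padic_lift_rowK mxE.
have [ts [ts_uniq szts tsP]] := exists_off_hyperplanes b s r2p v0.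
apply: (strong_taylor_vanish_line rp Psi_taylor ts_uniq szts) => t tts.
by apply: off_vanish => i; apply: tsP.
Qed.
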